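(* Let $G$ be a finite group and let $H$ be a subgroup of $G$. Let $\alpha,\beta$ be non-negative integers. (1) If $H$ is an $(\alpha,\beta)$-regular set of $G$, then $0\leq\alpha\leq|\mathrm{NSq}(G)\cap H|$ and $0\leq\beta\leq\mathcal{L}(H)$. (2) If $G$ is abelian, then $H$ is an $(\alpha,\beta)$-regular set of $G$ if and only if $0\leq\alpha\leq|\mathrm{NSq}(G)\cap H|$ and $0\leq\beta\leq\mathcal{L}(H)$.
   Context: An element $x$ of a group $G$ is a square if $x=y^2$ for some $y\in G$; $\mathrm{Sq}(G)$ and $\mathrm{NSq}(G)$ denote the sets of square and of non-square elements of $G$. A subset of $G$ is square-free if none of its elements is a square of $G$; a subset $S$ is normal if $g^{-1}Sg=S$ for all $g\in G$. For a normal square-free subset $S$ of $G$ (possibly empty), the Cayley sum graph $\mathrm{CayS}(G,S)$ is the simple graph with vertex set $G$ in which $x,y$ are adjacent if and only if $xy\in S$. A set $C$ of vertices of a graph is an $(\alpha,\beta)$-regular set in the graph if every vertex in $C$ is adjacent to exactly $\alpha$ vertices of $C$ and every vertex not in $C$ is adjacent to exactly $\beta$ vertices of $C$. A subset $C\subseteq G$ is an $(\alpha,\beta)$-regular set of $G$ if it is an $(\alpha,\beta)$-regular set in $\mathrm{CayS}(G,S)$ for some normal square-free subset $S$ of $G$. For a subgroup $H$ of $G$, $\mathcal{L}(H)=\min\{|\mathrm{NSq}(G)\cap Hx| : x\in G\setminus H\}$, where $Hx=\{hx:h\in H\}$. *)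

(* Defs.v *)
From HB Require Import structures.
From mathcomp Require Import all_boot all_order all_algebra all_fingroup.
From mathcomp Require Import constructive_ereal.

Set Implicit Arguments.
Unset Strict Implicit.
Unset Printing Implicit Defensive.

Import Order.TTheory GRing.Theory Num.Theory GroupScope.

Definition Sq (gT : finGroupType) (G : {set gT}) : {set gT} :=
  [set y ^+ 2 | y in G].

Definition NSq (gT : finGroupType) (G : {set gT}) : {set gT} := G :\: Sq G.

Definition normal_square_free (gT : finGroupType) (G S : {set gT}) : Prop :=
  [/\ S \subset G, {in G, normalised S} & [disjoint S & Sq G]].

(* Adjacency of the Cayley sum graph; its vertex set is the ambient group [G],
   which [regular_set_in] takes as a separate argument. *)
Definition CayS (gT : finGroupType) (S : {set gT}) : rel gT :=
  fun x y => x * y \in S.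

(* The graph has vertex set [V] and adjacency relation [e] restricted to [V]. *)
Definition regular_set_in (T : finType) (V : {set T}) (e : rel T)
    (a b : nat) (C : {set T}) : Prop :=
  [/\ C \subset V,
      forall x, x \in C -> #|[set y in C | e x y]| = a
    & forall x, x \in V :\: C -> #|[set y in C | e x y]| = b].

Definition regular_set (gT : finGroupType) (G : {set gT}) (a b : nat)
    (C : {set gT}) : Prop :=
  exists2 S : {set gT},
    normal_square_free G S & regular_set_in G (CayS S) a b C.

(* The minimum is taken in the extended integers, so that it is [+oo] for
   [H = G], where the family of cosets is empty. For a proper subgroup it is
   the usual (finite) minimum. *)
Definition calL (gT : finGroupType) (G H : {set gT}) : \bar int :=
  \big[Order.min/+oo%E]_(x in G :\: H) ((#|NSq G :&: H :* x|)%:Z)%:E.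

(* [CayS S] is a simple graph on [G]. *)
Lemma CayS_irr (gT : finGroupType) (G S : {set gT}) :
  normal_square_free G S -> {in G, irreflexive (CayS S)}.
Proof.
move=> [_ _ dS] x Gx; apply/negP => /(disjointFr dS).
by rewrite (imset_f (fun y => y ^+ 2)).
Qed.

Lemma CayS_sym (gT : finGroupType) (G S : {set gT}) :
  normal_square_free G S -> {in G &, symmetric (CayS S)}.
Proof.
move=> [_ nS _] x y Gx Gy; rewrite /CayS.
by rewrite -(memJ_conjg S x (x * y)) nS // conjgE -mulgA mulKg.
Qed.

(* Main.v *)
Require Import Defs.
From HB Require Import structures.
From mathcomp Require Import all_boot all_order all_algebra all_fingroup.
From mathcomp Require Import constructive_ereal.

Set Implicit Arguments.
Unset Strict Implicit.
Unset Printing Implicit Defensive.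

Import Order.TTheory GRing.Theory Num.Theory GroupScope.

(* Since S is normal, xy is in S iff yx is, so the neighbours of x in H are
   counted by |S :&: Hx|.  Hence H is (alpha, beta)-regular in CayS(G, S) iff
   |S :&: H| = alpha and |S :&: Hx| = beta for every x outside H.  The bounds
   follow from S \subset NSq(G).  In an abelian group every subset is normal,
   so the intersections of S with the cosets can be chosen independently. *)

Lemma normal_square_free_sub (gT : finGroupType) (G S : {set gT}) :
  normal_square_free G S -> S \subset NSq G.
Proof. by case=> sSG _ dS; rewrite subsetD sSG. Qed.

Lemma abelian_normal_square_free (gT : finGroupType) (G S : {set gT}) :
  abelian G -> S \subset NSq G -> normal_square_free G S.
Proof.
move=> abG /[!subsetD]/andP[sSG dS]; split=> // x Gx.
by apply/normP; apply: subsetP Gx; apply: sub_abelian_norm.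
Qed.

(** Right translation by [x] is injective and carries the neighbours of [x] in [H] onto the
    right-hand set, once [CayS_sym] has turned [x * y] into [y * x]. *)
Lemma card_nbr_coset (gT : finGroupType) (G H : {group gT}) (S : {set gT}) x :
    H \subset G -> normal_square_free G S -> x \in G ->
  #|[set y in H | CayS S x y]| = #|S :&: H :* x|.
Proof.
move=> sHG nsS Gx; rewrite -[LHS](card_imset _ (mulIg x)).
apply: eq_card => z; rewrite inE; apply/imsetP/andP=> [[y] | [Sz]].
  rewrite inE => /andP[Hy Sxy] ->; split; last by rewrite mem_rcoset mulgK.
  by move: Sxy; rewrite (CayS_sym nsS) ?(subsetP sHG y).
case/rcosetP=> y Hy def_z; exists y => //.
by rewrite inE Hy (CayS_sym nsS) ?(subsetP sHG y) // /CayS -def_z.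
Qed.

Lemma regular_set_inP (gT : finGroupType) (G H : {group gT}) (S : {set gT})
    a b :
    H \subset G -> normal_square_free G S ->
  regular_set_in G (CayS S) a b H <->
  #|S :&: H| = a /\ {in G :\: H, forall x, #|S :&: H :* x| = b}.
Proof.
move=> sHG nsS; split=> [[_ Ha Hb] | [Ha Hb]].
  split=> [|x GHx]; last first.
    by rewrite -(card_nbr_coset sHG nsS) ?Hb //; case/setDP: GHx.
  (* [H] is its own coset [H :* 1], so the vertex [1] supplies the count. *)
  by rewrite -{1}[H : {set gT}](mulg1 H) -(card_nbr_coset sHG nsS) ?Ha.
split=> // x => [Hx | GHx].
  by rewrite (card_nbr_coset sHG nsS) ?(subsetP sHG) // rcoset_id.
by rewrite (card_nbr_coset sHG nsS) ?Hb //; case/setDP: GHx.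
Qed.

(** The default [+oo] bounds every integer, so only the cosets constrain [b]; for [H = G] both sides
    hold trivially. *)
Lemma calL_geP (gT : finGroupType) (G H : {set gT}) (b : nat) :
  reflect {in G :\: H, forall x, b <= #|NSq G :&: H :* x|}
          (0 <= (b%:Z)%:E <= calL G H)%E.
Proof.
rewrite lee_fin /=.
apply: (iffP (bigmin_geP _ _ _ _)) => [[_ le_b] x /le_b | le_b].
  by rewrite lee_fin lez_nat.
by split=> [|x /le_b]; rewrite ?leey // lee_fin lez_nat.
Qed.

(** Each [z] is tested against a prefix of the enumeration of its own coset, which avoids choosing a
    transversal. *)
Definition coset_choice (gT : finGroupType) (H A : {set gT})
    (k : gT -> nat) : {set gT} :=
  [set z | z \in take (k z) (enum (A :&: H :* z))].

Lemma coset_choice_sub (gT : finGroupType) (H A : {set gT}) k :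
  coset_choice H A k \subset A.
Proof. by apply/subsetP=> z /[!inE]/mem_take; rewrite mem_enum => /setIP[]. Qed.

(** All points of [H :* x] are tested against the same prefix, since both their coset and their
    value of [k] agree; the bound on [k x] makes this prefix full length. *)
Lemma card_coset_choice (gT : finGroupType) (H : {group gT}) (A : {set gT})
    (k : gT -> nat) x :
    {in H :* x, forall z, k z = k x} -> k x <= #|A :&: H :* x| ->
  #|coset_choice H A k :&: H :* x| = k x.
Proof.
move=> kHx le_k; transitivity #|take (k x) (enum (A :&: H :* x))|.
  apply: eq_card => z; rewrite !inE; case Hxz: (z \in H :* x).
    by rewrite andbT kHx // (rcoset_eqP Hxz).
  rewrite andbF; apply/esym/negP => /mem_take.
  by rewrite mem_enum inE Hxz andbF.
have /card_uniqP-> := take_uniq (k x) (enum_uniq (A :&: H :* x)).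
by rewrite size_takel // -cardE.
Qed.

Theorem theorem2p9 (gT : finGroupType) (G H : {group gT})
    (sHG : H \subset G) (alpha beta : nat) :
  (regular_set G alpha beta H ->
     (0 <= alpha <= #|NSq G :&: H|)%N /\
     (0 <= (beta%:Z)%:E <= calL G H)%E) /\
  (abelian G ->
     (regular_set G alpha beta H <->
        (0 <= alpha <= #|NSq G :&: H|)%N /\
        (0 <= (beta%:Z)%:E <= calL G H)%E)).
Proof.
have bounds : regular_set G alpha beta H ->
    (0 <= alpha <= #|NSq G :&: H|)%N /\ (0 <= (beta%:Z)%:E <= calL G H)%E.
  case=> S nsS /(regular_set_inP _ _ sHG nsS)[<- Sbeta].
  have sSN := normal_square_free_sub nsS.
  split; first exact: subset_leq_card (setSI _ sSN).
  by apply/calL_geP => x /Sbeta <-; apply: subset_leq_card (setSI _ sSN).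
split=> // abG; split=> // -[le_alpha /calL_geP le_beta].
(* The prescribed sizes: constant on right cosets of [H], because [h * x] lies in [H] exactly when
   [x] does. *)
pose k z := if z \in H then alpha else beta.
have kE x : {in H :* x, forall z, k z = k x}.
  by move=> _ /rcosetP[h Hh ->]; rewrite /k groupMl.
have nsS := abelian_normal_square_free abG (coset_choice_sub H (NSq G) k).
exists (coset_choice H (NSq G) k) => //; apply/(regular_set_inP _ _ sHG nsS).
split=> [|x GHx].
  have k1 : k 1 = alpha by rewrite /k group1.
  by have := card_coset_choice (kE 1); rewrite mulg1 k1; apply.
have kx : k x = beta by case/setDP: GHx => _ /negPf nHx; rewrite /k nHx.
by have := card_coset_choice (kE x); rewrite kx; apply; apply: le_beta.
Qed.
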